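(* For $\gamma>0$ define $$g(\gamma)=\int_0^{+\infty}\gamma t\,\exp(-\gamma(1+t))\,I_0\!\left(2\gamma\sqrt t\right)\left(1-R^2\!\left(2\gamma\sqrt t\right)\right)\mathrm{d}t$$ and $$\hat g(\gamma)=\frac14\sqrt{\frac{\pi}{\gamma}}\,e^{-\gamma/2}\left(\left(1+\frac1\gamma\right)I_0(\gamma/2)+I_1(\gamma/2)\right).$$ Then the relative error of $1/\gamma-\hat g(\gamma)$ as an approximation of $1/\gamma-g(\gamma)$ satisfies $$r(\gamma)=\frac{|\hat g(\gamma)-g(\gamma)|}{1/\gamma-g(\gamma)}=\mathcal{O}\!\left(\frac1\gamma\right)\qquad\text{as }\gamma\to+\infty .$$
   Context: $I_\nu$ denotes the $\nu$-th order modified Bessel function of the first kind, and $R(z)=I_1(z)/I_0(z)$. *)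

(* Defs.v *)
From Stdlib Require Import Reals Factorial.
From Coquelicot Require Import Coquelicot.
Open Scope R_scope.

Definition bessel_I0 (z : R) : R :=
  Series (fun k => (z / 2) ^ (2 * k) / (INR (fact k) * INR (fact k))).

Definition bessel_I1 (z : R) : R :=
  Series (fun k => (z / 2) ^ (2 * k + 1) / (INR (fact k) * INR (fact (k + 1)))).

Definition bessel_R (z : R) : R := bessel_I1 z / bessel_I0 z.

Definition g_integrand (gamma t : R) : R :=
  gamma * t * exp (- gamma * (1 + t)) * bessel_I0 (2 * gamma * sqrt t)
  * (1 - (bessel_R (2 * gamma * sqrt t)) ^ 2).

Definition g (gamma : R) : R :=
  RInt_gen (g_integrand gamma) (at_point 0) (Rbar_locally p_infty).

Definition g_hat (gamma : R) : R :=
  / 4 * sqrt (PI / gamma) * exp (- gamma / 2)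
  * ((1 + / gamma) * bessel_I0 (gamma / 2) + bessel_I1 (gamma / 2)).

Definition rel_err (gamma : R) : R :=
  Rabs (g_hat gamma - g gamma) / (/ gamma - g gamma).

(* Main.v *)
(* Both g and g_hat equal 1/(2 gamma) + O(1/gamma^2), so 1/gamma - g >= 1/(4 gamma) for large
   gamma and the relative error is O(1/gamma).

   For g: comparing x (I_0^2 - I_1^2) - I_0 I_1 - c I_1^2 / x with 0 for c = 0 and c = 2 gives
   |1 - R(x)^2 - 1/x| <= 3/x^2 for all x > 0. At x = 2 gamma sqrt t the integrand is therefore
   w(t) (sqrt t / 2 + O(1/gamma)) with w(t) = exp(-gamma (1 + t)) I_0(2 gamma sqrt t), and sqrt t
   lies between two polynomials of degree at most 2 tangent to it at t = 1. The moments of w of order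
   0, 1, 2 are explicit, by termwise Laplace transform of the series of I_0.

   For g_hat: I_0(x) = sum_k c_k x^(2k) / (2k)! with c_k = binom(2k, k) / 4^k. Wallis'
   inequalities 2 / (pi (2k + 1)) <= c_k^2 <= 1 / (pi k) and linear or AM-GM bounds on the square
   root around 2k = x give I_0(x) = exp(x) / sqrt(2 pi x) (1 + O(1/x)). *)
Require Import Defs.
From Stdlib Require Import Reals Lra Lia Factorial.
From Coquelicot Require Import Coquelicot.
Open Scope R_scope.

(* Coquelicot leaves equations typed in a coerced structure, where [ring] and [field] fail. *)
Ltac eqR := lazymatch goal with |- @eq _ ?a ?b => change (@eq R a b) end.

(** * Factorials and series with nonnegative terms *)

Lemma INR_fact_pos (n : nat) : 0 < INR (fact n).
Proof. apply lt_0_INR, lt_O_fact. Qed.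

Lemma INR_fact_succ (n : nat) : INR (fact (S n)) = (INR n + 1) * INR (fact n).
Proof. rewrite fact_simpl, mult_INR, S_INR. ring. Qed.

Lemma is_series_le (a b : nat -> R) (la lb : R) :
  (forall n, a n <= b n) -> is_series a la -> is_series b lb -> la <= lb.
Proof.
intros Hab Ha Hb.
apply (is_lim_seq_le (sum_n a) (sum_n b) la lb).
- intros n. apply sum_n_m_le, Hab.
- exact Ha.
- exact Hb.
Qed.

Lemma is_series_Rplus (a b : nat -> R) (la lb : R) :
  is_series a la -> is_series b lb -> is_series (fun k => a k + b k) (la + lb).
Proof. exact (is_series_plus a b la lb). Qed.

Lemma is_series_Rscal (c : R) (a : nat -> R) (l : R) :
  is_series a l -> is_series (fun k => c * a k) (c * l).
Proof. exact (is_series_scal c a l). Qed.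

Lemma is_series_nonneg (a : nat -> R) (l : R) :
  (forall n, 0 <= a n) -> is_series a l -> 0 <= l.
Proof.
intros Ha Hl. apply (is_lim_seq_le (fun _ => 0) (sum_n a) 0 l).
- intros n. apply Rle_trans with (sum_n (fun _ => 0) n).
  + rewrite sum_n_const. lra.
  + now apply sum_n_m_le.
- apply is_lim_seq_const.
- exact Hl.
Qed.

Lemma sum_n_le_is_series (a : nat -> R) (l : R) (N : nat) :
  (forall n, 0 <= a n) -> is_series a l -> sum_n a N <= l.
Proof.
intros Ha Hl. apply (is_lim_seq_incr_compare (sum_n a) l Hl).
intros n. rewrite sum_Sn. unfold plus; simpl. assert (H := Ha (S n)). lra.
Qed.

Lemma term_le_is_series (a : nat -> R) (l : R) (N : nat) :
  (forall n, 0 <= a n) -> is_series a l -> a N <= l.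
Proof.
intros Ha Hl. apply Rle_trans with (2 := sum_n_le_is_series a l N Ha Hl).
destruct N as [|N]; [rewrite sum_O; lra|].
rewrite sum_Sn. assert (H : 0 <= sum_n a N).
{ apply Rle_trans with (sum_n (fun _ => 0) N).
  - rewrite sum_n_const. lra.
  - now apply sum_n_m_le. }
unfold plus; simpl. lra.
Qed.

(** * The ratio of modified Bessel functions *)

(* With [s = x^2/4], [I_0(x) = PSeries coefI0 s] and [I_1(x) = (x/2) PSeries coefI1 s]. *)
Definition coefI0 (k : nat) : R := / (INR (fact k) * INR (fact k)).
Definition coefI1 (k : nat) : R := / (INR (fact k) * INR (fact (k + 1))).

Lemma coefI0_pos (k : nat) : 0 < coefI0 k.
Proof.
apply Rinv_0_lt_compat, Rmult_lt_0_compat; apply INR_fact_pos.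
Qed.

Lemma CV_radius_coefI0 : CV_radius coefI0 = p_infty.
Proof.
apply CV_radius_infinite_DAlembert.
- intros n. apply Rgt_not_eq, coefI0_pos.
- apply is_lim_seq_le_le with (fun _ => 0) (fun n => / INR (S n)).
  + intros n. split; [apply Rabs_pos|].
    assert (Hf := INR_fact_pos n). assert (Hn := pos_INR n).
    rewrite Rabs_pos_eq.
    * replace (coefI0 (S n) / coefI0 n) with (/ INR (S n) * / INR (S n)).
      -- rewrite S_INR. rewrite <- (Rmult_1_r (/ (INR n + 1))) at 3.
         apply Rmult_le_compat_l.
         ++ left. apply Rinv_0_lt_compat. lra.
         ++ rewrite <- Rinv_1. apply Rinv_le_contravar; lra.
      -- unfold coefI0. rewrite INR_fact_succ, S_INR. field. split; lra.
    * left. apply Rdiv_lt_0_compat; apply coefI0_pos.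
  + apply is_lim_seq_const.
  + apply (is_lim_seq_incr_1 (fun n => / INR n)).
    replace (Finite 0) with (Rbar_inv p_infty) by reflexivity.
    apply is_lim_seq_inv; [apply is_lim_seq_INR | discriminate].
Qed.

(** Termwise form of [I_0' = I_1] in the variable [x^2/4]. It also carries the infinite radius of
    convergence over to [coefI1]. *)
Lemma coefI1_derive (k : nat) : PS_derive coefI0 k = coefI1 k.
Proof.
unfold PS_derive, coefI0, coefI1. rewrite Nat.add_1_r, INR_fact_succ, S_INR.
assert (Hf := INR_fact_pos k). assert (Hn := pos_INR k). field. lra.
Qed.

Lemma CV_radius_coefI1 : CV_radius coefI1 = p_infty.
Proof.
rewrite <- (CV_radius_ext _ _ coefI1_derive), CV_radius_derive.
apply CV_radius_coefI0.
Qed.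

Lemma is_series_PSeries_entire (a : nat -> R) (x : R) :
  CV_radius a = p_infty -> is_series (fun k => a k * x ^ k) (PSeries a x).
Proof.
intros Ha. apply Series_correct, ex_series_Rabs, CV_disk_inside.
rewrite Ha. exact I.
Qed.

Lemma is_derive_PSeries_entire (a : nat -> R) (x : R) :
  CV_radius a = p_infty -> is_derive (PSeries a) x (PSeries (PS_derive a) x).
Proof. intros Ha. apply is_derive_PSeries. rewrite Ha. exact I. Qed.

(** Given by its power series rather than by a quotient, so that it is differentiable at 0, with
    value 1/2 there. *)
Definition I1_over_x (x : R) : R := / 2 * PSeries coefI1 (x ^ 2 / 4).

Lemma bessel_I0_PSeries (x : R) : bessel_I0 x = PSeries coefI0 (x ^ 2 / 4).
Proof.
apply Series_ext. intros k. unfold coefI0. rewrite pow_mult.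
replace ((x / 2) ^ 2) with (x ^ 2 / 4) by field.
unfold Rdiv at 1. ring.
Qed.

Lemma bessel_I1_PSeries (x : R) : bessel_I1 x = x * I1_over_x x.
Proof.
unfold I1_over_x.
replace (x * (/ 2 * PSeries coefI1 (x ^ 2 / 4)))
  with (x / 2 * PSeries coefI1 (x ^ 2 / 4)) by field.
unfold PSeries. rewrite <- Series_scal_l.
apply Series_ext. intros k. unfold coefI1. rewrite pow_add, pow_mult.
replace ((x / 2) ^ 2) with (x ^ 2 / 4) by field.
unfold Rdiv at 1. ring.
Qed.

Lemma bessel_I0_ge_1 (x : R) : 1 <= bessel_I0 x.
Proof.
rewrite bessel_I0_PSeries.
assert (H0 : 0 <= x ^ 2 / 4) by nra.
replace 1 with (coefI0 0 * (x ^ 2 / 4) ^ 0) by (unfold coefI0; simpl; field).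
refine (term_le_is_series _ _ 0 _ (is_series_PSeries_entire _ _ CV_radius_coefI0)).
intros k. apply Rmult_le_pos; [left; apply coefI0_pos | now apply pow_le].
Qed.

Lemma I1_over_x_nonneg (x : R) : 0 <= I1_over_x x.
Proof.
unfold I1_over_x. apply Rmult_le_pos; [lra|].
assert (H0 : 0 <= x ^ 2 / 4) by nra.
refine (is_series_nonneg _ _ _ (is_series_PSeries_entire _ _ CV_radius_coefI1)).
intros n. apply Rmult_le_pos; [|now apply pow_le].
left. apply Rinv_0_lt_compat, Rmult_lt_0_compat; apply INR_fact_pos.
Qed.

(** Termwise, from [k! <= (k+1)!]. It settles the sign of the derivative of [barrier 2], which is
    [-3 j (i - 2 j)] with [i = I_0] and [j = I_1/x]. *)
Lemma I1_over_x_le (x : R) : 2 * I1_over_x x <= bessel_I0 x.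
Proof.
rewrite bessel_I0_PSeries. unfold I1_over_x.
replace (2 * (/ 2 * PSeries coefI1 (x ^ 2 / 4))) with (PSeries coefI1 (x ^ 2 / 4)) by field.
assert (H0 : 0 <= x ^ 2 / 4) by nra.
refine (is_series_le _ _ _ _ _ (is_series_PSeries_entire _ _ CV_radius_coefI1)
  (is_series_PSeries_entire _ _ CV_radius_coefI0)).
intros k. apply Rmult_le_compat_r; [now apply pow_le|].
unfold coefI0, coefI1. assert (Hf := INR_fact_pos k).
apply Rinv_le_contravar; [now apply Rmult_lt_0_compat|].
apply Rmult_le_compat_l; [lra|]. apply le_INR, fact_le. lia.
Qed.

Lemma is_derive_bessel_I0 (x : R) : is_derive bessel_I0 x (bessel_I1 x).
Proof.
apply (is_derive_ext (fun x => PSeries coefI0 (x ^ 2 / 4))).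
{ intros t. symmetry. apply bessel_I0_PSeries. }
evar_last.
{ apply (is_derive_comp (PSeries coefI0) (fun x => x ^ 2 / 4)).
  - apply is_derive_PSeries_entire, CV_radius_coefI0.
  - auto_derive; reflexivity. }
rewrite bessel_I1_PSeries. unfold I1_over_x.
rewrite (PSeries_ext _ _ _ coefI1_derive). unfold scal; simpl; unfold mult; simpl. field.
Qed.

(** Coefficientwise this is [(k+1) coefI1 k = coefI0 k], the series form of [(x I_1)' = x I_0]. *)
Lemma PSeries_coefI0_eq (s : R) :
  PSeries coefI0 s = PSeries coefI1 s + s * PSeries (PS_derive coefI1) s.
Proof.
rewrite <- PSeries_incr_1.
rewrite <- PSeries_plus.
- apply PSeries_ext. intros [|k].
  + change (coefI0 0 = coefI1 0 + 0). unfold coefI0, coefI1. simpl. field.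
  + change (coefI0 (S k) = coefI1 (S k) + INR (S k) * coefI1 (S k)).
    unfold coefI0, coefI1. rewrite Nat.add_1_r, !INR_fact_succ, !S_INR.
    assert (Hf := INR_fact_pos k). assert (Hn := pos_INR k). field. lra.
- apply CV_radius_inside. rewrite CV_radius_coefI1. exact I.
- apply ex_pseries_incr_1, CV_radius_inside. rewrite CV_radius_derive, CV_radius_coefI1. exact I.
Qed.

(** The recurrence [I_1' = I_0 - I_1/x] rewritten for [I_1/x], multiplied by [x] so that it also
    holds at 0. *)
Lemma is_derive_I1_over_x (x : R) :
  exists d, is_derive I1_over_x x d /\ x * d = bessel_I0 x - 2 * I1_over_x x.
Proof.
exists (x / 4 * PSeries (PS_derive coefI1) (x ^ 2 / 4)). split.
- evar_last.
  { apply is_derive_scal, (is_derive_comp (PSeries coefI1) (fun x => x ^ 2 / 4)).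
    - apply is_derive_PSeries_entire, CV_radius_coefI1.
    - auto_derive; reflexivity. }
  unfold scal; simpl; unfold mult; simpl. field.
- rewrite bessel_I0_PSeries, PSeries_coefI0_eq. unfold I1_over_x. field.
Qed.

(* [barrier c x / (x I_0^2)] is [1 - R^2 - R/x - c R^2/x^2]; its derivative, computed from the
   Bessel recurrences, is nonnegative for [c = 0] and nonpositive for [c = 2]. *)
Definition barrier (c x : R) : R :=
  x * (bessel_I0 x ^ 2 - bessel_I1 x ^ 2) - bessel_I0 x * bessel_I1 x
  - c * bessel_I1 x * I1_over_x x.

Lemma is_derive_barrier (c x : R) :
  is_derive (barrier c) x
    ((1 - 2 * c) * bessel_I0 x * I1_over_x x + 3 * c * I1_over_x x ^ 2).
Proof.
destruct (is_derive_I1_over_x x) as [d [Hd Hxd]].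
assert (Hi := is_derive_bessel_I0 x).
apply (is_derive_ext (fun x => x * (bessel_I0 x ^ 2 - x ^ 2 * I1_over_x x ^ 2)
  - bessel_I0 x * (x * I1_over_x x) - c * x * I1_over_x x * I1_over_x x)).
{ intros t. unfold barrier. rewrite bessel_I1_PSeries. eqR. ring. }
auto_derive.
- repeat split; first [now exists (bessel_I1 x) | now exists d].
- replace (Derive (fun x => bessel_I0 x) x) with (bessel_I1 x)
    by (symmetry; now apply is_derive_unique).
  replace (Derive (fun x => I1_over_x x) x) with d
    by (symmetry; now apply is_derive_unique).
  rewrite bessel_I1_PSeries.
  set (i := bessel_I0 x) in *. set (j := I1_over_x x) in *.
  (* Each factor [i - 2 * j] is placed where the raw derivative contains [x * d]. *)
  replace ((1 - 2 * c) * i * j + 3 * c * j ^ 2) with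
    (i ^ 2 - x ^ 2 * j ^ 2 + 2 * x * x * i * j - 2 * x ^ 2 * j ^ 2 - 2 * x ^ 2 * j * (i - 2 * j)
     - i * j - x ^ 2 * j ^ 2 - i * (i - 2 * j) - c * j ^ 2 - 2 * c * j * (i - 2 * j)) by ring.
  rewrite <- Hxd. ring.
Qed.

(** [barrier c] vanishes at 0, so the mean value theorem transfers the sign of its derivative to the
    function itself. *)
Lemma barrier_mean_value (c x : R) (f := barrier c) :
  0 < x -> exists y, f x = x *
    ((1 - 2 * c) * bessel_I0 y * I1_over_x y + 3 * c * I1_over_x y ^ 2).
Proof.
intros Hx.
destruct (MVT_gen f 0 x (fun y => (1 - 2 * c) * bessel_I0 y * I1_over_x y
  + 3 * c * I1_over_x y ^ 2)) as [y [_ Hy]].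
- intros y _. apply is_derive_barrier.
- intros y _. apply continuity_pt_filterlim.
  apply (ex_derive_continuous f). eexists. apply is_derive_barrier.
- exists y. replace (f 0) with 0 in Hy.
  + rewrite Rminus_0_r, Rminus_0_r in Hy. rewrite Hy. ring.
  + unfold f, barrier. rewrite bessel_I1_PSeries. ring.
Qed.

Lemma bessel_R_nonneg (x : R) : 0 <= x -> 0 <= bessel_R x.
Proof.
intros Hx. assert (H := bessel_I0_ge_1 x). unfold bessel_R.
apply Rdiv_le_0_compat; [|lra].
rewrite bessel_I1_PSeries. apply Rmult_le_pos; [easy | apply I1_over_x_nonneg].
Qed.

Lemma bessel_R_lower (x : R) : 0 < x -> bessel_R x / x <= 1 - bessel_R x ^ 2.
Proof.
intros Hx. assert (H := bessel_I0_ge_1 x).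
destruct (barrier_mean_value 0 x Hx) as [y Hy].
assert (Hj := I1_over_x_nonneg y). assert (Hi := bessel_I0_ge_1 y).
assert (H0 : 0 <= barrier 0 x).
{ rewrite Hy. apply Rmult_le_pos; [lra|].
  assert (0 <= bessel_I0 y * I1_over_x y) by (apply Rmult_le_pos; lra). nra. }
apply Rminus_le_0.
replace (1 - bessel_R x ^ 2 - bessel_R x / x) with (barrier 0 x / (x * bessel_I0 x ^ 2)).
- apply Rdiv_le_0_compat; [easy|]. apply Rmult_lt_0_compat; [easy|]. apply pow_lt. lra.
- unfold barrier, bessel_R. field. lra.
Qed.

Lemma bessel_R_upper (x : R) :
  0 < x -> 1 - bessel_R x ^ 2 <= bessel_R x / x + 2 * bessel_R x ^ 2 / x ^ 2.
Proof.
intros Hx. assert (H := bessel_I0_ge_1 x).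
destruct (barrier_mean_value 2 x Hx) as [y Hy].
assert (Hj := I1_over_x_nonneg y). assert (Hi := I1_over_x_le y).
assert (H0 : 0 <= - barrier 2 x).
{ rewrite Hy. rewrite Ropp_mult_distr_r. apply Rmult_le_pos; [lra|].
  replace (- _) with (3 * I1_over_x y * (bessel_I0 y - 2 * I1_over_x y)) by ring.
  apply Rmult_le_pos; lra. }
apply Rminus_le_0.
replace (_ - _) with (- barrier 2 x / (x * bessel_I0 x ^ 2)).
- apply Rdiv_le_0_compat; [easy|]. apply Rmult_lt_0_compat; [easy|]. apply pow_lt. lra.
- unfold barrier, bessel_R. replace (I1_over_x x) with (bessel_I1 x / x).
  + field. lra.
  + rewrite bessel_I1_PSeries. field. lra.
Qed.

Lemma bessel_R_le_1 (x : R) : 0 < x -> bessel_R x <= 1.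
Proof.
intros Hx. assert (H := bessel_R_lower x Hx).
assert (H1 := bessel_R_nonneg x (Rlt_le _ _ Hx)).
assert (0 <= bessel_R x / x) by (now apply Rdiv_le_0_compat). nra.
Qed.

Lemma one_minus_bessel_R_sqr_le (x : R) :
  0 < x -> 1 - bessel_R x ^ 2 <= / x + 2 * / x ^ 2.
Proof.
intros Hx. assert (H := bessel_R_upper x Hx).
assert (H1 := bessel_R_nonneg x (Rlt_le _ _ Hx)). assert (H2 := bessel_R_le_1 x Hx).
assert (H3 := Rinv_0_lt_compat x Hx).
assert (H4 : 0 < / x ^ 2) by (apply Rinv_0_lt_compat, pow_lt, Hx).
unfold Rdiv in H. assert (bessel_R x ^ 2 <= 1) by nra. nra.
Qed.

(** [1 - R <= 1 - R^2] because [0 <= R <= 1]. *)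
Lemma one_minus_bessel_R_le (x : R) :
  0 < x -> 1 - bessel_R x <= / x + 2 * / x ^ 2.
Proof.
intros Hx. assert (H := one_minus_bessel_R_sqr_le x Hx).
assert (H1 := bessel_R_nonneg x (Rlt_le _ _ Hx)). assert (H2 := bessel_R_le_1 x Hx).
nra.
Qed.

Lemma one_minus_bessel_R_sqr_asymptotic (x : R) :
  0 < x -> Rabs (1 - bessel_R x ^ 2 - / x) <= 3 * / x ^ 2.
Proof.
intros Hx. assert (H := one_minus_bessel_R_sqr_le x Hx).
assert (Hl := bessel_R_lower x Hx). assert (Hr := one_minus_bessel_R_le x Hx).
assert (H1 := bessel_R_nonneg x (Rlt_le _ _ Hx)). assert (H2 := bessel_R_le_1 x Hx).
assert (H3 := Rinv_0_lt_compat x Hx). unfold Rdiv in Hl.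
rewrite <- pow_inv in H, Hr |- *. set (u := / x) in *.
apply Rabs_le. split; [|nra].
(* [bessel_R_lower] gives [1 - R^2 - u >= - u (1 - R)]. For [u <= 1] the bound [1 - R <= u + 2 u^2]
   finishes; for [u > 1] the bound [1 - R <= 1] does. *)
destruct (Rle_lt_dec u 1); nra.
Qed.

(** * Wallis' inequalities and the asymptotics of I_0 *)

Definition central (k : nat) : R :=
  INR (fact (2 * k)) / (4 ^ k * (INR (fact k) * INR (fact k))).

Lemma central_pos (k : nat) : 0 < central k.
Proof.
apply Rdiv_lt_0_compat; [apply INR_fact_pos|].
apply Rmult_lt_0_compat; [apply pow_lt; lra|].
apply Rmult_lt_0_compat; apply INR_fact_pos.
Qed.

Lemma central_succ (k : nat) :
  (2 * INR k + 2) * central (S k) = (2 * INR k + 1) * central k.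
Proof.
unfold central. replace (2 * S k)%nat with (S (S (2 * k))) by lia.
rewrite !INR_fact_succ, S_INR, mult_INR. simpl pow. change (INR 2) with 2.
assert (Hf := INR_fact_pos k). assert (Hn := pos_INR k).
assert (0 < 4 ^ k) by (apply pow_lt; lra).
field. lra.
Qed.

Definition wallis (n : nat) : R := RInt (fun x => sin x ^ n) 0 (PI / 2).

Lemma continuous_sin_pow (n : nat) (x : R) : continuous (fun x => sin x ^ n) x.
Proof. apply (ex_derive_continuous (fun x => sin x ^ n)). auto_derive. exact I. Qed.

Lemma is_RInt_wallis (n : nat) : is_RInt (fun x => sin x ^ n) 0 (PI / 2) (wallis n).
Proof.
apply (RInt_correct (V := R_CompleteNormedModule)), ex_RInt_continuous.
intros x _. apply continuous_sin_pow.
Qed.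

Lemma wallis_0 : wallis 0 = PI / 2.
Proof.
unfold wallis. rewrite (RInt_ext _ (fun _ => 1)) by reflexivity.
rewrite RInt_const. unfold scal; simpl; unfold mult; simpl. ring.
Qed.

Lemma wallis_1 : wallis 1 = 1.
Proof.
apply is_RInt_unique. evar_last.
{ apply (is_RInt_derive (fun x => - cos x)).
  - intros x _. auto_derive; [exact I | simpl; ring].
  - intros x _. apply continuous_sin_pow. }
rewrite cos_PI2, cos_0. unfold minus, plus, opp; simpl. ring.
Qed.

(** Integration by parts: [df] is the derivative of [sin^(n+1) cos], which vanishes at both
    endpoints. *)
Lemma wallis_succ2 (n : nat) : (INR n + 2) * wallis (S (S n)) = (INR n + 1) * wallis n.
Proof.
set (df := fun x => (INR n + 1) * sin x ^ n - (INR n + 2) * sin x ^ S (S n)).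
assert (H1 : is_RInt df 0 (PI / 2) ((INR n + 1) * wallis n - (INR n + 2) * wallis (S (S n)))).
{ apply (is_RInt_minus (V := R_NormedModule));
    apply (is_RInt_scal (V := R_NormedModule)); apply is_RInt_wallis. }
assert (H2 : is_RInt df 0 (PI / 2) 0).
{ evar_last.
  { apply (is_RInt_derive (fun x => sin x ^ S n * cos x)).
    - intros x _. auto_derive; [exact I|].
      change (match n with O => 1 | S _ => INR n + 1 end) with (INR (S n)).
      unfold df. rewrite S_INR. simpl pow.
      assert (H := sin2_cos2 x). unfold Rsqr in H.
      transitivity ((INR n + 1) * sin x ^ n * (cos x * cos x)
        - sin x ^ n * (sin x * sin x)); [ring|].
      replace (cos x * cos x) with (1 - sin x * sin x) by lra. ring.
    - intros x _. apply (ex_derive_continuous df). unfold df. auto_derive. exact I. }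
  rewrite cos_PI2, sin_0. unfold minus, plus, opp; simpl. ring. }
assert (H := is_RInt_unique _ _ _ _ H1). rewrite (is_RInt_unique _ _ _ _ H2) in H. lra.
Qed.

Lemma wallis_decr (n : nat) : wallis (S n) <= wallis n.
Proof.
assert (Hpi := PI_RGT_0).
refine (is_RInt_le _ _ _ _ _ _ _ (is_RInt_wallis (S n)) (is_RInt_wallis n) _); [lra|].
intros x Hx. simpl.
assert (0 <= sin x) by (apply sin_ge_0; lra).
assert (H1 := SIN_bound x). assert (0 <= sin x ^ n) by now apply pow_le. nra.
Qed.

Lemma wallis_even (k : nat) : wallis (2 * k) = PI / 2 * central k.
Proof.
induction k as [|k IHk].
- simpl. rewrite wallis_0. unfold central. simpl. field.
- replace (2 * S k)%nat with (S (S (2 * k))) by lia.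
  assert (Hn := pos_INR k).
  assert (H := wallis_succ2 (2 * k)). rewrite mult_INR in H. change (INR 2) with 2 in H.
  apply (Rmult_eq_reg_l (2 * INR k + 2)); [|lra].
  rewrite H, IHk. assert (Hc := central_succ k).
  transitivity (PI / 2 * ((2 * INR k + 1) * central k)); [ring|]. rewrite <- Hc. ring.
Qed.

Lemma wallis_odd (k : nat) : wallis (2 * k + 1) * ((2 * INR k + 1) * central k) = 1.
Proof.
induction k as [|k IHk].
- simpl. rewrite wallis_1. unfold central. simpl. field.
- replace (2 * S k + 1)%nat with (S (S (2 * k + 1))) by lia.
  assert (Hn := pos_INR k).
  assert (H := wallis_succ2 (2 * k + 1)). rewrite plus_INR, mult_INR in H.
  change (INR 2) with 2 in H.
  change (INR 1) with 1 in H. rewrite <- central_succ in IHk. rewrite S_INR.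
  transitivity ((2 * INR k + 1 + 2) * wallis (S (S (2 * k + 1))) * central (S k)); [ring|].
  rewrite H.
  transitivity (wallis (2 * k + 1) * ((2 * INR k + 2) * central (S k))); [ring | exact IHk].
Qed.

(** [W_(2k+1) <= W_(2k)], multiplied by [(2k+1) c_k] so that the left side becomes 1. *)
Lemma central_sqr_lower (k : nat) : 2 <= PI * (2 * INR k + 1) * central k ^ 2.
Proof.
assert (H := wallis_decr (2 * k)). rewrite wallis_even in H.
assert (H1 := wallis_odd k). rewrite Nat.add_1_r in H1.
assert (Hc := central_pos k). assert (Hn := pos_INR k).
assert (0 < (2 * INR k + 1) * central k) by (apply Rmult_lt_0_compat; lra).
apply (Rmult_le_compat_r ((2 * INR k + 1) * central k)) in H; lra.
Qed.

(** [W_(2k+2) <= W_(2k+1)], multiplied by [(2k+2) c_(k+1) = (2k+1) c_k] so that the right side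
    becomes 1. *)
Lemma central_sqr_upper (k : nat) : PI * INR (S k) * central (S k) ^ 2 <= 1.
Proof.
assert (H := wallis_decr (2 * k + 1)).
replace (S (2 * k + 1)) with (2 * S k)%nat in H by lia. rewrite wallis_even in H.
assert (H1 := wallis_odd k). rewrite <- central_succ in H1.
assert (Hc := central_pos (S k)). assert (Hn := pos_INR k).
assert (0 < (2 * INR k + 2) * central (S k)) by (apply Rmult_lt_0_compat; lra).
apply (Rmult_le_compat_r ((2 * INR k + 2) * central (S k))) in H; [|lra].
rewrite S_INR. lra.
Qed.

Lemma sum_n_even_odd (a : nat -> R) (n : nat) :
  sum_n (fun k => a (2 * k)%nat + a (2 * k + 1)%nat) n = sum_n a (2 * n + 1).
Proof.
induction n as [|n IHn].
- rewrite sum_O. simpl. rewrite sum_Sn, sum_O. reflexivity.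
- rewrite sum_Sn, IHn. replace (2 * S n + 1)%nat with (S (S (2 * n + 1))) by lia.
  rewrite !sum_Sn. replace (2 * S n)%nat with (S (2 * n + 1)) by lia.
  replace (S (2 * n + 1) + 1)%nat with (S (S (2 * n + 1))) by lia.
  unfold plus; simpl. ring.
Qed.

Lemma is_series_even_odd (a : nat -> R) (l : R) :
  is_series a l -> is_series (fun k => a (2 * k)%nat + a (2 * k + 1)%nat) l.
Proof.
intros H.
apply (is_lim_seq_ext (fun n => sum_n a (2 * n + 1)) _ (Finite l)).
- intros n. symmetry. apply sum_n_even_odd.
- apply (is_lim_seq_subseq (sum_n a) l (fun n => (2 * n + 1)%nat)); [|exact H].
  apply eventually_subseq. intros n. lia.
Qed.

Lemma is_series_exp (x : R) : is_series (fun k => x ^ k / INR (fact k)) (exp x).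
Proof.
apply (is_series_ext (fun k => scal (pow_n x k) (/ INR (fact k)))).
- intros n. rewrite pow_n_pow. reflexivity.
- apply is_exp_Reals.
Qed.

Lemma is_series_even_exp (x : R) :
  is_series (fun k => x ^ (2 * k) / INR (fact (2 * k))) (cosh x).
Proof.
assert (H1 := is_series_even_odd _ _ (is_series_exp x)).
assert (H2 := is_series_even_odd _ _ (is_series_exp (- x))).
assert (H := is_series_Rscal (/ 2) _ _ (is_series_Rplus _ _ _ _ H1 H2)).
evar_last.
- eapply is_series_ext; [|exact H]. intros k. eqR. cbv beta.
  rewrite !pow_add, !pow_mult. replace ((- x) ^ 2) with (x ^ 2) by ring.
  field. split; apply Rgt_not_eq, INR_fact_pos.
- unfold cosh. field.
Qed.

Lemma is_series_odd_exp (x : R) :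
  is_series (fun k => x ^ (2 * k + 1) / INR (fact (2 * k + 1))) (sinh x).
Proof.
assert (H1 := is_series_even_odd _ _ (is_series_exp x)).
assert (H := is_series_Rplus _ _ _ _ H1
  (is_series_Rscal (- 1) _ _ (is_series_even_exp x))).
evar_last.
- eapply is_series_ext; [|exact H]. intros k. eqR. cbv beta. ring.
- unfold cosh, sinh. field.
Qed.

(** Presents [I_0] as the series of [cosh] with weights [c_k], so that bounds on [c_k] sum to bounds
    on [I_0]. *)
Lemma bessel_I0_central (x : R) :
  is_series (fun k => x ^ (2 * k) / INR (fact (2 * k)) * central k) (bessel_I0 x).
Proof.
rewrite bessel_I0_PSeries.
eapply is_series_ext; [|exact (is_series_PSeries_entire _ (x ^ 2 / 4) CV_radius_coefI0)].
intros k. unfold coefI0, central. rewrite pow_mult. eqR. unfold Rdiv at 1.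
rewrite Rpow_mult_distr, pow_inv. field.
assert (H1 := INR_fact_pos k). assert (H2 := INR_fact_pos (2 * k)).
assert (H3 : 0 < 4 ^ k) by (apply pow_lt; lra). lra.
Qed.

Lemma sqrt_2_PI_x_sqr (x : R) : 0 < x -> sqrt (2 / (PI * x)) ^ 2 = 2 / (PI * x).
Proof.
intros Hx. assert (Hpi := PI_RGT_0). apply pow2_sqrt.
apply Rdiv_le_0_compat; [lra|]. now apply Rmult_lt_0_compat.
Qed.

Lemma pow2_incr_le (a b : R) : 0 <= b -> a ^ 2 <= b ^ 2 -> a <= b.
Proof. intros Hb H. nra. Qed.

(* The two bounds on [central] turn its decay [1 / sqrt k], via Wallis, into expressions in [k]
   whose sums against [x^(2k) / (2k)!] are elementary and sharp near [2k = x]. *)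
Lemma central_upper (x : R) (k : nat) : 0 < x ->
  central k <= sqrt (2 / (PI * x)) *
    (/ 2 + x / 2 * (/ (2 * INR k + 1) + 2 * / ((2 * INR k + 1) * (2 * INR k + 2)))).
Proof.
intros Hx. assert (Hpi := PI_RGT_0). assert (Hpi4 := PI_4).
(* For [k >= 1], [r] is at least [1/(2k)]. Its form makes [x r] times [x^(2k)/(2k)!] a term of
   [sinh] plus [2/x] times a shifted term of [cosh]. *)
set (r := _ + 2 * _). assert (Hk := pos_INR k).
assert (Hr : 0 < r).
{ unfold r. apply Rplus_lt_0_compat; [apply Rinv_0_lt_compat; lra|].
  apply Rmult_lt_0_compat; [lra|]. apply Rinv_0_lt_compat, Rmult_lt_0_compat; lra. }
assert (Hxr : 0 < x * r) by now apply Rmult_lt_0_compat.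
apply pow2_incr_le.
{ apply Rmult_le_pos; [apply sqrt_pos|]. nra. }
rewrite Rpow_mult_distr, sqrt_2_PI_x_sqr by easy.
(* AM-GM applied to [1] and [x r]. *)
assert (Hamgm : x * r <= (/ 2 + x / 2 * r) ^ 2).
{ assert (H := pow2_ge_0 (1 - x * r)). nra. }
apply Rle_trans with (2 / (PI * x) * (x * r)).
- replace (2 / (PI * x) * (x * r)) with (2 * r / PI) by (field; lra).
  (* The goal is now [PI c_k^2 <= 2 r]. Wallis' upper bound covers [k >= 1]; at [k = 0] the claim is
     [PI <= 4]. *)
  apply (Rle_div_r _ _ _ Hpi). destruct k as [|k].
  + replace (central 0) with 1 by (unfold central; simpl; field).
    replace r with 2 by (unfold r; simpl; field). lra.
  + assert (H := central_sqr_upper k). rewrite S_INR in *.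
    assert (Hk0 := pos_INR k).
    assert (H2 : central (S k) ^ 2 * PI <= / (INR k + 1)).
    { apply (Rmult_le_reg_l (INR k + 1)); [lra|]. rewrite Rinv_r by lra. lra. }
    apply Rle_trans with (1 := H2). apply Rminus_le_0.
    replace (2 * r - / (INR k + 1)) with
      (/ ((INR k + 1) * (INR k + 2) * (2 * INR k + 3)) * INR k).
    * apply Rmult_le_pos; [|lra]. left. apply Rinv_0_lt_compat.
      repeat apply Rmult_lt_0_compat; lra.
    * unfold r. rewrite S_INR. field. lra.
- apply Rmult_le_compat_l; [|easy]. apply Rdiv_le_0_compat; [lra|].
  now apply Rmult_lt_0_compat.
Qed.

Lemma central_lower (x : R) (k : nat) : 0 < x ->
  sqrt (2 / (PI * x)) * (3 / 2 - (2 * INR k + 1) / (2 * x)) <= central k.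
Proof.
intros Hx. assert (Hpi := PI_RGT_0). assert (Hk := pos_INR k).
assert (Hc := central_pos k). assert (Hs := sqrt_pos (2 / (PI * x))).
replace ((2 * INR k + 1) / (2 * x)) with ((2 * INR k + 1) / x / 2) by (field; lra).
(* [3/2 - y/2] is the tangent to the convex function [1 / sqrt y] at [y = 1]. Where it is
   nonpositive there is nothing to prove. *)
set (y := (2 * INR k + 1) / x). assert (Hy : 0 < y) by (apply Rdiv_lt_0_compat; lra).
destruct (Rle_lt_dec (3 / 2 - y / 2) 0) as [H0|H0]; [nra|].
apply pow2_incr_le; [lra|].
rewrite Rpow_mult_distr, sqrt_2_PI_x_sqr by easy.
apply Rle_trans with (2 / (PI * x) * / y).
- apply Rmult_le_compat_l.
  { apply Rdiv_le_0_compat; [lra|]. now apply Rmult_lt_0_compat. }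
  apply (Rmult_le_reg_l y); [easy|]. rewrite Rinv_r by lra.
  (* This product equals [4 - y (3 - y)^2], so its sign is the square of the tangent inequality. *)
  assert (0 <= (y - 1) ^ 2 * (4 - y)) by (apply Rmult_le_pos; [apply pow2_ge_0 | lra]).
  nra.
- assert (H := central_sqr_lower k).
  replace (2 / (PI * x) * / y) with (2 / (PI * (2 * INR k + 1))) by (unfold y; field; lra).
  apply Rle_div_l; [apply Rmult_lt_0_compat; lra | lra].
Qed.

(** The three terms of [central_upper], summed against [x^(2k)/(2k)!], give [cosh x / 2],
    [sinh x / 2] and [(cosh x - 1) / x]. *)
Lemma bessel_I0_upper (x : R) : 0 < x ->
  bessel_I0 x <= sqrt (2 / (PI * x)) * (exp x / 2 * (1 + 2 / x)).
Proof.
intros Hx.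
assert (Hc := is_series_even_exp x). assert (Hs := is_series_odd_exp x).
assert (Hc' : is_series (fun k => x ^ (2 * S k) / INR (fact (2 * S k))) (cosh x - 1)).
{ apply (is_series_incr_1 (fun k => x ^ (2 * k) / INR (fact (2 * k)))).
  evar_last; [exact Hc|]. unfold plus; simpl. eqR. field. }
set (K := sqrt (2 / (PI * x))). assert (HK : 0 <= K) by apply sqrt_pos.
assert (HS := is_series_Rscal K _ _
  (is_series_Rplus _ _ _ _ (is_series_Rscal (/ 2) _ _ (is_series_Rplus _ _ _ _ Hc Hs))
    (is_series_Rscal (/ x) _ _ Hc'))).
refine (Rle_trans _ _ _ (is_series_le _ _ _ _ _ (bessel_I0_central x) HS) _).
- intros k. cbv beta. assert (Hk := pos_INR k).
  assert (Ha : 0 < x ^ (2 * k) / INR (fact (2 * k)))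
    by (apply Rdiv_lt_0_compat; [now apply pow_lt | apply INR_fact_pos]).
  refine (Rle_trans _ _ _ (Rmult_le_compat_l _ _ _ (Rlt_le _ _ Ha)
    (central_upper x k Hx)) (Req_le _ _ _)).
  fold K. replace (2 * S k)%nat with (S (S (2 * k))) by lia. rewrite Nat.add_1_r.
  rewrite !INR_fact_succ, S_INR, mult_INR. change (INR 2) with 2.
  simpl pow at 2 3. assert (H := INR_fact_pos (2 * k)). simpl pow. field. lra.
- apply Rmult_le_compat_l; [easy|]. unfold cosh, sinh.
  assert (H : exp (- x) <= exp x) by (left; apply exp_increasing; lra).
  assert (H1 : exp (- x) <= 1) by (rewrite <- exp_0; left; apply exp_increasing; lra).
  assert (Hx' := Rinv_0_lt_compat x Hx). unfold Rdiv. nra.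
Qed.

(** The factor [2k] in [central_lower] acts on the series of [cosh] as [x d/dx], giving [x sinh x].
    For [x >= 1] the leftover multiple of [exp (- x)] is nonnegative. *)
Lemma bessel_I0_lower (x : R) : 1 <= x ->
  sqrt (2 / (PI * x)) * (exp x / 2 * (1 - / (2 * x))) <= bessel_I0 x.
Proof.
intros Hx. assert (Hx0 : 0 < x) by lra.
assert (Hc := is_series_even_exp x). assert (Hs := is_series_odd_exp x).
assert (Hd : is_series (fun k => INR (2 * k) * (x ^ (2 * k) / INR (fact (2 * k)))) (x * sinh x)).
{ apply is_series_decr_1. evar_last.
  - eapply is_series_ext; [|exact (is_series_Rscal x _ _ Hs)].
    intros k. eqR. cbv beta. replace (2 * S k)%nat with (S (2 * k + 1)) by lia.
    rewrite INR_fact_succ, S_INR. simpl pow.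
    assert (H := INR_fact_pos (2 * k + 1)). assert (Hk := pos_INR (2 * k + 1)).
    field. lra.
  - unfold plus, opp; simpl. eqR. ring. }
set (K := sqrt (2 / (PI * x))). assert (HK : 0 <= K) by apply sqrt_pos.
assert (HS := is_series_Rscal K _ _
  (is_series_Rplus _ _ _ _ (is_series_Rscal (3 / 2 - / (2 * x)) _ _ Hc)
    (is_series_Rscal (- / (2 * x)) _ _ Hd))).
refine (Rle_trans _ _ _ _ (is_series_le _ _ _ _ _ HS (bessel_I0_central x))).
- apply Rmult_le_compat_l; [easy|]. unfold cosh, sinh.
  assert (H := exp_pos (- x)). assert (H1 := exp_pos x).
  assert (Hi : / (2 * x) <= / 2) by (apply Rinv_le_contravar; lra).
  assert (Hi' : 0 < / (2 * x)) by (apply Rinv_0_lt_compat; lra).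
  replace (- / (2 * x) * (x * ((exp x - exp (- x)) / 2))) with
    (- (exp x - exp (- x)) / 4) by (field; lra).
  nra.
- intros k. cbv beta.
  assert (Ha : 0 < x ^ (2 * k) / INR (fact (2 * k)))
    by (apply Rdiv_lt_0_compat; [now apply pow_lt | apply INR_fact_pos]).
  refine (Rle_trans _ _ _ (Req_le _ _ _) (Rmult_le_compat_l _ _ _ (Rlt_le _ _ Ha)
    (central_lower x k Hx0))).
  fold K. rewrite mult_INR. change (INR 2) with 2. field.
  split; [lra|]. apply Rgt_not_eq, INR_fact_pos.
Qed.

(** * Laplace transforms of power series *)

Lemma continuous_exp_pow (s : R) (n : nat) (t : R) :
  continuous (fun t => exp (- s * t) * t ^ n) t.
Proof.
apply (ex_derive_continuous (fun t => exp (- s * t) * t ^ n)). auto_derive. exact I.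
Qed.

Definition inc_gamma (s : R) (n : nat) (T : R) : R :=
  RInt (fun t => exp (- s * t) * t ^ n) 0 T.

Lemma is_RInt_inc_gamma (s : R) (n : nat) (T : R) :
  is_RInt (fun t => exp (- s * t) * t ^ n) 0 T (inc_gamma s n T).
Proof.
apply (RInt_correct (V := R_CompleteNormedModule)), ex_RInt_continuous.
intros t _. apply continuous_exp_pow.
Qed.

Lemma inc_gamma_0 (s T : R) : s <> 0 -> inc_gamma s 0 T = (1 - exp (- s * T)) / s.
Proof.
intros Hs. apply is_RInt_unique. evar_last.
{ apply (is_RInt_derive (fun t => - exp (- s * t) / s)).
  - intros t _. auto_derive; [easy | simpl; field; easy].
  - intros t _. apply continuous_exp_pow. }
unfold minus, plus, opp; simpl. replace (- s * 0) with 0 by ring. rewrite exp_0.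
field. easy.
Qed.

(** Integration by parts: [df] is the derivative of [t^(n+1) exp (- s t) / s]. *)
Lemma inc_gamma_succ (s : R) (n : nat) (T : R) : s <> 0 ->
  inc_gamma s (S n) T = (INR n + 1) / s * inc_gamma s n T - T ^ S n * exp (- s * T) / s.
Proof.
intros Hs.
set (df := fun t => (INR n + 1) / s * (exp (- s * t) * t ^ n) - exp (- s * t) * t ^ S n).
assert (H1 : is_RInt df 0 T ((INR n + 1) / s * inc_gamma s n T - inc_gamma s (S n) T)).
{ apply (is_RInt_minus (V := R_NormedModule)); [|apply is_RInt_inc_gamma].
  apply (is_RInt_scal (V := R_NormedModule)), is_RInt_inc_gamma. }
assert (H2 : is_RInt df 0 T (T ^ S n * exp (- s * T) / s)).
{ evar_last.
  { apply (is_RInt_derive (fun t => t ^ S n * exp (- s * t) / s)).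
    - intros t _. auto_derive; [easy|].
      change (match n with O => 1 | S _ => INR n + 1 end) with (INR (S n)).
      unfold df. rewrite S_INR. simpl pow. field. easy.
    - intros t _. apply (ex_derive_continuous df). unfold df. auto_derive. exact I. }
  unfold minus, plus, opp; simpl. field. easy. }
assert (H := is_RInt_unique _ _ _ _ H1). rewrite (is_RInt_unique _ _ _ _ H2) in H. lra.
Qed.

Lemma inc_gamma_le (s : R) (n : nat) (T : R) : 0 < s -> 0 <= T ->
  inc_gamma s n T <= INR (fact n) / s ^ (n + 1).
Proof.
intros Hs HT. induction n as [|n IHn].
- rewrite inc_gamma_0 by lra. assert (H := exp_pos (- s * T)). simpl.
  rewrite Rmult_1_r. apply Rmult_le_compat_r; [|lra].
  left. now apply Rinv_0_lt_compat.
- rewrite inc_gamma_succ by lra. assert (Hn := pos_INR n).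
  assert (0 <= T ^ S n * exp (- s * T) / s).
  { apply Rdiv_le_0_compat; [|easy].
    apply Rmult_le_pos; [now apply pow_le | left; apply exp_pos]. }
  apply Rle_trans with ((INR n + 1) / s * (INR (fact n) / s ^ (n + 1))).
  + assert (0 < (INR n + 1) / s) by (apply Rdiv_lt_0_compat; lra). nra.
  + apply Req_le. rewrite INR_fact_succ. simpl. field.
    split; [apply pow_nonzero|]; lra.
Qed.

(** [exp (s T)] dominates the term of order [n + 1] of its series, which leaves a factor [1/T]. *)
Lemma is_lim_pow_exp (s : R) (n : nat) :
  0 < s -> is_lim (fun T => T ^ n * exp (- s * T)) p_infty 0.
Proof.
intros Hs.
apply (is_lim_le_le_loc (fun _ => 0) (fun T => INR (fact (S n)) / s ^ S n * / T)).
- exists 0. intros T HT. split.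
  { apply Rmult_le_pos; [apply pow_le; lra | left; apply exp_pos]. }
  assert (HsT : 0 < s * T) by now apply Rmult_lt_0_compat.
  assert (H := term_le_is_series _ _ (S n) (fun k => Rdiv_le_0_compat _ _
    (pow_le (s * T) k (Rlt_le _ _ HsT)) (INR_fact_pos k)) (is_series_exp (s * T))).
  cbv beta in H. replace (- s * T) with (- (s * T)) by ring. rewrite exp_Ropp.
  assert (Hf := INR_fact_pos (S n)).
  assert (Hp : 0 < (s * T) ^ S n / INR (fact (S n)))
    by (apply Rdiv_lt_0_compat; [now apply pow_lt | easy]).
  apply Rle_trans with (T ^ n * / ((s * T) ^ S n / INR (fact (S n)))).
  + apply Rmult_le_compat_l; [apply pow_le; lra|]. now apply Rinv_le_contravar.
  + apply Req_le. rewrite Rpow_mult_distr. simpl pow. field.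
    repeat split; try apply pow_nonzero; lra.
- apply is_lim_const.
- replace (Finite 0) with (Rbar_mult (INR (fact (S n)) / s ^ S n) (Rbar_inv p_infty))
    by (simpl; f_equal; ring).
  apply is_lim_scal_l, is_lim_inv; [apply is_lim_id | discriminate].
Qed.

Lemma is_lim_inc_gamma (s : R) (n : nat) : 0 < s ->
  is_lim (inc_gamma s n) p_infty (INR (fact n) / s ^ (n + 1)).
Proof.
intros Hs. induction n as [|n IHn].
- apply (is_lim_ext (fun T => / s - / s * (T ^ 0 * exp (- s * T)))).
  + intros T. rewrite inc_gamma_0 by lra. simpl. field. lra.
  + evar_last.
    * apply (is_lim_minus' (fun _ => / s) _ _ (/ s) (/ s * 0)); [apply is_lim_const|].
      apply (is_lim_scal_l _ (/ s) _ 0), is_lim_pow_exp, Hs.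
    * simpl. f_equal. field. lra.
- apply (is_lim_ext (fun T => (INR n + 1) / s * inc_gamma s n T
    - / s * (T ^ S n * exp (- s * T)))).
  + intros T. rewrite inc_gamma_succ by lra. field. lra.
  + evar_last.
    * apply (is_lim_minus' _ _ _ ((INR n + 1) / s * (INR (fact n) / s ^ (n + 1))) (/ s * 0)).
      -- apply (is_lim_scal_l _ ((INR n + 1) / s) _ _ IHn).
      -- apply (is_lim_scal_l _ (/ s) _ 0), is_lim_pow_exp, Hs.
    * rewrite INR_fact_succ. simpl. f_equal. field. split; [apply pow_nonzero|]; lra.
Qed.

Lemma is_RInt_exp_poly (s : R) (c : nat -> R) (j N : nat) (T : R) :
  is_RInt (fun t => exp (- s * t) * t ^ j * sum_n (fun k => c k * t ^ k) N) 0 T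
    (sum_n (fun k => c k * inc_gamma s (k + j) T) N).
Proof.
induction N as [|N IHN].
- rewrite sum_O. eapply is_RInt_ext; [|exact (is_RInt_scal (V := R_NormedModule) _ _ _ (c 0%nat) _
    (is_RInt_inc_gamma s j T))].
  intros t _. rewrite sum_O. unfold scal; simpl; unfold mult; simpl. ring.
- rewrite sum_Sn.
  eapply is_RInt_ext; [|exact (is_RInt_plus (V := R_NormedModule) _ _ _ _ _ _ IHN
   (is_RInt_scal (V := R_NormedModule) _ _ _ (c (S N)) _
    (is_RInt_inc_gamma s (S N + j) T)))].
  intros t _. rewrite sum_Sn, pow_add. unfold scal, plus; simpl; unfold mult; simpl. eqR. ring.
Qed.

Lemma is_lim_sum_n (f : nat -> R -> R) (l : nat -> R) (N : nat) :
  (forall k, is_lim (f k) p_infty (l k)) ->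
  is_lim (fun T => sum_n (fun k => f k T) N) p_infty (sum_n l N).
Proof.
intros Hf. induction N as [|N IHN].
- rewrite sum_O. apply (is_lim_ext (f 0%nat)); [|easy].
  intros T. now rewrite sum_O.
- rewrite sum_Sn. apply (is_lim_ext (fun T => sum_n (fun k => f k T) N + f (S N) T)).
  + intros T. now rewrite sum_Sn.
  + now apply (is_lim_plus' _ _ _ (sum_n l N) (l (S N))).
Qed.

Section Laplace.

Variables (s : R) (c : nat -> R) (phi : R -> R) (j : nat) (S0 : R).
Hypothesis s_pos : 0 < s.
Hypothesis c_nonneg : forall k, 0 <= c k.
Hypothesis phi_series : forall t, 0 <= t -> is_series (fun k => c k * t ^ k) (phi t).
Hypothesis phi_cont : forall t, continuous phi t.
Hypothesis S0_series :
  is_series (fun k => c k * (INR (fact (k + j)) / s ^ (k + j + 1))) S0.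

Let h (t : R) := exp (- s * t) * t ^ j * phi t.

Lemma is_RInt_laplace (T : R) : is_RInt h 0 T (RInt h 0 T).
Proof.
apply (RInt_correct (V := R_CompleteNormedModule)), ex_RInt_continuous.
intros t _. apply (continuous_mult (fun t => exp (- s * t) * t ^ j) phi);
  [apply continuous_exp_pow | apply phi_cont].
Qed.

Lemma laplace_ge_partial (N : nat) (T : R) : 0 <= T ->
  sum_n (fun k => c k * inc_gamma s (k + j) T) N <= RInt h 0 T.
Proof.
intros HT.
apply (is_RInt_le _ _ _ _ _ _ HT (is_RInt_exp_poly s c j N T) (is_RInt_laplace T)).
intros t Ht. unfold h. apply Rmult_le_compat_l.
- apply Rmult_le_pos; [left; apply exp_pos | apply pow_le; lra].
- apply sum_n_le_is_series; [|apply phi_series; lra].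
  intros k. apply Rmult_le_pos; [easy | apply pow_le; lra].
Qed.

(* The tails of a power series with nonnegative coefficients are nondecreasing, which makes the
   convergence uniform on [0, T]. *)
Lemma phi_tail_le (N : nat) (t T : R) : 0 <= t <= T ->
  phi t - sum_n (fun k => c k * t ^ k) N <= phi T - sum_n (fun k => c k * T ^ k) N.
Proof.
intros Ht.
assert (Hd : is_series (fun k => c k * T ^ k + -1 * (c k * t ^ k)) (phi T + -1 * phi t)).
{ apply is_series_Rplus; [apply phi_series; lra|].
  apply is_series_Rscal, phi_series. lra. }
assert (H := fun H0 => sum_n_le_is_series _ _ N H0 Hd). cbv beta in H.
enough (Hs : sum_n (fun k => c k * T ^ k + -1 * (c k * t ^ k)) N =
  sum_n (fun k => c k * T ^ k) N - sum_n (fun k => c k * t ^ k) N).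
{ rewrite Hs in H. enough (forall k, 0 <= c k * T ^ k + -1 * (c k * t ^ k)) as H0.
  - specialize (H H0). lra.
  - intros k. assert (Hp := pow_incr t T k Ht). assert (Hc := c_nonneg k). nra. }
clear. induction N as [|N IHN].
- rewrite !sum_O. eqR. ring.
- rewrite !sum_Sn, IHN. unfold plus; simpl. eqR. ring.
Qed.

(** Replacing [phi] by a partial sum costs at most the tail at [T], by [phi_tail_le]. With [T]
    fixed, this cost tends to 0 as the partial sum grows. *)
Lemma laplace_le (T : R) : 0 <= T -> RInt h 0 T <= S0.
Proof.
intros HT.
(* Length of the interval, times the maximum of [t^j], times the largest tail; the exponential is at
   most 1. *)
set (eps := fun N => T * T ^ j * (phi T - sum_n (fun k => c k * T ^ k) N)).
assert (Heps : is_lim_seq (fun N => S0 + eps N) S0).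
{ evar_last.
  - apply (is_lim_seq_plus' (fun _ => S0) eps S0 (T * T ^ j * (phi T - phi T))).
    + apply is_lim_seq_const.
    + apply (is_lim_seq_scal_l _ (T * T ^ j) (phi T - phi T)).
      apply (is_lim_seq_minus' (fun _ => phi T) _ (phi T) (phi T)).
      * apply is_lim_seq_const.
      * exact (phi_series T HT).
  - simpl. f_equal. ring. }
apply (is_lim_seq_le (fun _ => RInt h 0 T) (fun N => S0 + eps N) (RInt h 0 T) S0);
  [|apply is_lim_seq_const | exact Heps].
intros N.
apply Rle_trans with (sum_n (fun k => c k * inc_gamma s (k + j) T) N + eps N).
- assert (Hi := is_RInt_plus (V := R_NormedModule) _ _ _ _ _ _ (is_RInt_exp_poly s c j N T)
    (is_RInt_const (V := R_NormedModule) 0 T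
      (T ^ j * (phi T - sum_n (fun k => c k * T ^ k) N)))).
  replace (sum_n _ N + eps N) with
    (plus (sum_n (fun k => c k * inc_gamma s (k + j) T) N)
      (scal (T - 0) (T ^ j * (phi T - sum_n (fun k => c k * T ^ k) N)))).
  + apply (is_RInt_le _ _ _ _ _ _ HT (is_RInt_laplace T) Hi).
    intros t Ht. unfold h, plus; simpl.
    assert (Htail := phi_tail_le N t T ltac:(lra)).
    assert (He : exp (- s * t) <= 1).
    { rewrite <- exp_0. left. apply exp_increasing. nra. }
    assert (He0 := exp_pos (- s * t)).
    assert (Hp := pow_incr t T j ltac:(lra)). assert (Hp0 := pow_le t j ltac:(lra)).
    assert (H0 : 0 <= phi t - sum_n (fun k => c k * t ^ k) N).
    { apply Rle_minus_r. rewrite Rplus_0_l. apply sum_n_le_is_series; [|apply phi_series; lra].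
      intros k. apply Rmult_le_pos; [easy | apply pow_le; lra]. }
    set (u := sum_n (fun k => c k * t ^ k) N) in *.
    set (v := phi T - sum_n (fun k => c k * T ^ k) N) in *.
    assert (exp (- s * t) * t ^ j <= T ^ j) by nra.
    assert (exp (- s * t) * t ^ j * (phi t - u) <= T ^ j * v).
    { apply Rmult_le_compat; [apply Rmult_le_pos; lra | | |]; easy. }
    lra.
  + unfold eps, plus, scal; simpl; unfold mult; simpl. eqR. ring.
- apply Rplus_le_compat_r.
  apply Rle_trans with (2 := sum_n_le_is_series _ _ N
    (fun k => Rmult_le_pos _ _ (c_nonneg k) (Rdiv_le_0_compat _ _ (pos_INR _)
      (pow_lt _ _ s_pos))) S0_series).
  apply sum_n_m_le. intros k. apply Rmult_le_compat_l; [easy|]. now apply inc_gamma_le.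
Qed.

(** The integral lies between a partial sum of incomplete transforms and [S0]. First [N] is chosen
    to bring the complete partial sum near [S0], then [T] to bring the incomplete one near it. *)
Lemma is_lim_laplace : is_lim (fun T => RInt h 0 T) p_infty S0.
Proof.
apply is_lim_spec. intros eps. simpl.
assert (squeeze : forall a b m l e, Rabs (a - b) < e / 2 -> Rabs (b - l) < e / 2 ->
  a <= m -> m <= l -> Rabs (m - l) < e).
{ intros a b m l e Ha Hb Hm Hl. apply Rabs_def2 in Ha. apply Rabs_def2 in Hb.
  apply Rabs_def1; lra. }
assert (He : 0 < eps / 2) by (assert (H := cond_pos eps); lra).
set (e2 := mkposreal (eps / 2) He).
assert (HN := proj2 (is_lim_seq_spec _ (Finite S0)) S0_series e2).
destruct HN as [N HN]. specialize (HN N (Nat.le_refl N)). simpl in HN.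
assert (Hl : is_lim (fun T => sum_n (fun k => c k * inc_gamma s (k + j) T) N) p_infty
  (sum_n (fun k => c k * (INR (fact (k + j)) / s ^ (k + j + 1))) N)).
{ apply (is_lim_sum_n (fun k T => c k * inc_gamma s (k + j) T)
    (fun k => c k * (INR (fact (k + j)) / s ^ (k + j + 1)))).
  intros k. apply (is_lim_scal_l _ (c k) _ (Finite (INR (fact (k + j)) / s ^ (k + j + 1)))).
  now apply is_lim_inc_gamma. }
apply is_lim_spec in Hl. destruct (Hl e2) as [M HM]. simpl in HM.
exists (Rmax M 0). intros T HT.
assert (HT1 := Rmax_l M 0). assert (HT2 := Rmax_r M 0).
specialize (HM T ltac:(lra)).
assert (H1 := laplace_ge_partial N T ltac:(lra)). assert (H2 := laplace_le T ltac:(lra)).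
refine (squeeze _ _ _ _ _ HM HN H1 H2).
Qed.

End Laplace.

(** * Moments of the exponential series and of the weight *)

Lemma is_series_mult_index (a : nat -> R) (x l : R) :
  is_series (fun k => a (S k) * (x ^ k / INR (fact k))) l ->
  is_series (fun k => INR k * a k * (x ^ k / INR (fact k))) (x * l).
Proof.
(* The term [k = 0] vanishes, and [(k+1)/(k+1)! = 1/k!] absorbs the shift of index. *)
intros Ha. apply is_series_decr_1. evar_last.
- eapply is_series_ext; [|exact (is_series_Rscal x _ _ Ha)].
  intros k. eqR. cbv beta. rewrite INR_fact_succ, S_INR. simpl pow.
  assert (Hf := INR_fact_pos k). assert (Hk := pos_INR k). field. lra.
- unfold plus, opp; simpl. eqR. ring.
Qed.

Lemma is_series_exp_moment1 (x : R) :
  is_series (fun k => INR k * (x ^ k / INR (fact k))) (x * exp x).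
Proof.
eapply is_series_ext; [|apply (is_series_mult_index (fun _ => 1) x (exp x))].
- intros k. eqR. cbv beta. ring.
- eapply is_series_ext; [|exact (is_series_exp x)]. intros k. eqR. cbv beta. ring.
Qed.

Lemma is_series_exp_moment2 (x : R) :
  is_series (fun k => INR k * (INR k - 1) * (x ^ k / INR (fact k))) (x * (x * exp x)).
Proof.
apply (is_series_mult_index (fun k => INR k - 1)).
eapply is_series_ext; [|exact (is_series_exp_moment1 x)].
intros k. eqR. cbv beta. rewrite S_INR. ring.
Qed.

(* For [t >= 0] this is [exp (- s (1 + t)) I_0(2 s sqrt t)]; [s * weight s] is a probability
   density with mean [1 + 1/s] and variance [2/s + 1/s^2]. *)
Definition weight (s t : R) : R := exp (- s * (1 + t)) * PSeries coefI0 (s ^ 2 * t).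

Lemma bessel_I0_weight (s t : R) : 0 <= t ->
  bessel_I0 (2 * s * sqrt t) = PSeries coefI0 (s ^ 2 * t).
Proof.
intros Ht. rewrite bessel_I0_PSeries. f_equal.
rewrite !Rpow_mult_distr, pow2_sqrt by easy. field.
Qed.

Lemma continuous_weight_series (s t : R) : continuous (fun t => PSeries coefI0 (s ^ 2 * t)) t.
Proof.
apply (continuous_comp (fun t => s ^ 2 * t) (PSeries coefI0)).
- apply (ex_derive_continuous (fun t => s ^ 2 * t)). auto_derive. exact I.
- apply (ex_derive_continuous (PSeries coefI0)). eexists.
  apply is_derive_PSeries_entire, CV_radius_coefI0.
Qed.

Lemma continuous_weight (s t : R) : continuous (weight s) t.
Proof.
apply (continuous_mult (fun t => exp (- s * (1 + t))) (fun t => PSeries coefI0 (s ^ 2 * t))).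
- apply (ex_derive_continuous (fun t => exp (- s * (1 + t)))). auto_derive. exact I.
- apply continuous_weight_series.
Qed.

Definition weight_moment (s : R) (j : nat) (T : R) : R :=
  RInt (fun t => weight s t * t ^ j) 0 T.

Lemma is_RInt_weight_moment (s : R) (j : nat) (T : R) :
  is_RInt (fun t => weight s t * t ^ j) 0 T (weight_moment s j T).
Proof.
apply (RInt_correct (V := R_CompleteNormedModule)), ex_RInt_continuous.
intros t _. apply (continuous_mult (weight s) (fun t => t ^ j)).
- apply continuous_weight.
- apply (ex_derive_continuous (fun t => t ^ j)). auto_derive. exact I.
Qed.

(** The transform of the [k]-th term is [s^(2k)/(k!)^2] times [(k+j)!/s^(k+j+1)]. The powers of [s]
    cancel, leaving an exponential series weighted by the polynomial [(k+j)!/k!] in [k]. *)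
Lemma weight_moment_limit (s : R) (j : nat) (L : R) : 0 < s ->
  is_series (fun k => INR (fact (k + j)) / INR (fact k) * (s ^ k / INR (fact k))) L ->
  let M := exp (- s) * L / s ^ (j + 1) in
  (forall T, 0 <= T -> weight_moment s j T <= M) /\ is_lim (weight_moment s j) p_infty M.
Proof.
intros Hs HL M.
set (c := fun k => coefI0 k * (s ^ 2) ^ k).
set (phi := fun t => PSeries coefI0 (s ^ 2 * t)).
assert (Hc : forall k, 0 <= c k).
{ intros k. apply Rmult_le_pos; [left; apply coefI0_pos|]. apply pow_le, pow2_ge_0. }
assert (Hphi : forall t, 0 <= t -> is_series (fun k => c k * t ^ k) (phi t)).
{ intros t _. eapply is_series_ext;
    [|exact (is_series_PSeries_entire coefI0 (s ^ 2 * t) CV_radius_coefI0)].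
  intros k. unfold c. eqR. rewrite Rpow_mult_distr. ring. }
assert (HS : is_series (fun k => c k * (INR (fact (k + j)) / s ^ (k + j + 1))) (L / s ^ (j + 1))).
{ replace (L / s ^ (j + 1)) with (/ s ^ (j + 1) * L) by (unfold Rdiv; ring).
  eapply is_series_ext; [|exact (is_series_Rscal (/ s ^ (j + 1)) _ _ HL)].
  intros k. unfold c, coefI0. eqR. cbv beta. rewrite <- Nat.add_assoc, (pow_add s k).
  rewrite <- pow_mult, Nat.mul_comm, pow_mult.
  replace ((s ^ k) ^ 2) with (s ^ k * s ^ k) by ring.
  field. repeat split; try apply pow_nonzero; try apply Rgt_not_eq, INR_fact_pos; lra. }
assert (Heq : forall T, weight_moment s j T =
  exp (- s) * RInt (fun t => exp (- s * t) * t ^ j * phi t) 0 T).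
{ intros T. apply is_RInt_unique.
  eapply is_RInt_ext; [|exact (is_RInt_scal (V := R_NormedModule) _ _ _ (exp (- s)) _
    (is_RInt_laplace s phi j (continuous_weight_series s) T))].
  intros t _. unfold scal; simpl; unfold mult; simpl. unfold weight, phi.
  replace (- s * (1 + t)) with (- s + - s * t) by ring. rewrite exp_plus. eqR. ring. }
unfold M. split.
- intros T HT. rewrite Heq. unfold Rdiv. rewrite Rmult_assoc.
  apply Rmult_le_compat_l; [left; apply exp_pos|].
  exact (laplace_le s c phi j _ Hs Hc Hphi (continuous_weight_series s) HS T HT).
- apply (is_lim_ext (fun T => exp (- s) * RInt (fun t => exp (- s * t) * t ^ j * phi t) 0 T)).
  + intros T. now rewrite Heq.
  + replace (exp (- s) * L / s ^ (j + 1)) with (exp (- s) * (L / s ^ (j + 1)))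
      by (unfold Rdiv; ring).
    apply (is_lim_scal_l _ (exp (- s)) _ (Finite (L / s ^ (j + 1)))).
    exact (is_lim_laplace s c phi j _ Hs Hc Hphi (continuous_weight_series s) HS).
Qed.

Lemma weight_moment_0 (s : R) : 0 < s ->
  (forall T, 0 <= T -> weight_moment s 0 T <= / s) /\
  is_lim (weight_moment s 0) p_infty (/ s).
Proof.
intros Hs.
replace (/ s) with (exp (- s) * exp s / s ^ (0 + 1)).
- apply (weight_moment_limit s 0 (exp s) Hs).
  eapply is_series_ext; [|exact (is_series_exp s)].
  intros k. eqR. rewrite Nat.add_0_r. field. apply Rgt_not_eq, INR_fact_pos.
- rewrite <- exp_plus, Rplus_opp_l, exp_0. simpl. field. lra.
Qed.

Lemma weight_moment_1 (s : R) : 0 < s ->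
  (forall T, 0 <= T -> weight_moment s 1 T <= / s * (1 + / s)) /\
  is_lim (weight_moment s 1) p_infty (/ s * (1 + / s)).
Proof.
intros Hs.
replace (/ s * (1 + / s)) with (exp (- s) * (s * exp s + exp s) / s ^ (1 + 1)).
- apply (weight_moment_limit s 1 (s * exp s + exp s) Hs).
  eapply is_series_ext; [|exact (is_series_Rplus _ _ _ _ (is_series_exp_moment1 s)
    (is_series_exp s))].
  intros k. eqR. cbv beta. rewrite Nat.add_1_r, INR_fact_succ.
  field. apply Rgt_not_eq, INR_fact_pos.
- replace (exp (- s) * (s * exp s + exp s)) with ((s + 1) * (exp (- s) * exp s)) by ring.
  rewrite <- exp_plus, Rplus_opp_l, exp_0. simpl. field. lra.
Qed.

Lemma weight_moment_2 (s : R) : 0 < s ->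
  is_lim (weight_moment s 2) p_infty (/ s * (1 + 4 * / s + 2 * / s ^ 2)).
Proof.
intros Hs.
replace (/ s * (1 + 4 * / s + 2 * / s ^ 2)) with
  (exp (- s) * (s * (s * exp s) + (4 * (s * exp s) + 2 * exp s)) / s ^ (2 + 1)).
- apply (weight_moment_limit s 2 (s * (s * exp s) + (4 * (s * exp s) + 2 * exp s)) Hs).
  (* [(k+1)(k+2) = k(k-1) + 4k + 2], expanded in the factorial moments of the exponential series. *)
  eapply is_series_ext; [|exact (is_series_Rplus _ _ _ _ (is_series_exp_moment2 s)
    (is_series_Rplus _ _ _ _ (is_series_Rscal 4 _ _ (is_series_exp_moment1 s))
       (is_series_Rscal 2 _ _ (is_series_exp s))))].
  intros k. eqR. cbv beta. replace (k + 2)%nat with (S (S k)) by lia.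
  rewrite !INR_fact_succ, S_INR.
  field. apply Rgt_not_eq, INR_fact_pos.
- transitivity ((s ^ 2 + 4 * s + 2) * (exp (- s) * exp s) / s ^ (2 + 1)).
  + unfold Rdiv. ring.
  + rewrite <- exp_plus, Rplus_opp_l, exp_0. simpl. field. lra.
Qed.

(** * Asymptotics of g and g_hat *)

(** The integral over [[0, T]] increases with [T] and is bounded, so it converges to its supremum
    [l]. Convergence is what allows the value of [RInt_gen] to be identified. *)
Lemma is_RInt_gen_nonneg_bounded (f : R -> R) (U : R) :
  (forall t, continuous f t) -> (forall t, 0 < t -> 0 <= f t) ->
  (forall T, 0 <= T -> RInt f 0 T <= U) ->
  exists l, is_RInt_gen f (at_point 0) (Rbar_locally p_infty) l /\ l <= U /\
    forall T, 0 <= T -> RInt f 0 T <= l.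
Proof.
intros Hc Hf HU.
assert (HI : forall T, is_RInt f 0 T (RInt f 0 T)).
{ intros T. apply (RInt_correct (V := R_CompleteNormedModule)), ex_RInt_continuous. easy. }
destruct (completeness (fun y => exists T, 0 <= T /\ y = RInt f 0 T)) as [l [Hl1 Hl2]].
{ exists U. intros y [T [HT ->]]. now apply HU. }
{ exists (RInt f 0 0), 0. split; [lra | easy]. }
assert (HFl : forall T, 0 <= T -> RInt f 0 T <= l).
{ intros T HT. apply Hl1. now exists T. }
exists l. split; [|split; [|easy]].
- intros P [eps HP].
  assert (HT0 : exists T0, 0 <= T0 /\ l - eps < RInt f 0 T0).
  { destruct (Classical_Prop.classic (exists T0, 0 <= T0 /\ l - eps < RInt f 0 T0)) as [H|H];
      [easy|].
    assert (l <= l - eps).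
    { apply Hl2. intros y [T [HT ->]]. apply Rnot_lt_le. intros Hlt. apply H. now exists T. }
    assert (He := cond_pos eps). lra. }
  destruct HT0 as [T0 [HT0 Hlt]].
  apply (Filter_prod _ _ _ (fun a => a = 0) (fun b => T0 < b)).
  + reflexivity.
  + now exists T0.
  + intros a b -> Hb. exists (RInt f 0 b). split; [apply HI|].
    apply HP. apply Rabs_def1.
    * assert (H := HFl b ltac:(lra)). assert (He := cond_pos eps).
      unfold minus, plus, opp; simpl. lra.
    * assert (Hm : 0 <= RInt f T0 b).
      { apply RInt_ge_0; [lra | | intros t Ht; apply Hf; lra].
        apply (ex_RInt_continuous (V := R_CompleteNormedModule)). easy. }
      assert (Hch := RInt_Chasles (V := R_CompleteNormedModule) f 0 T0 b
        (ex_intro _ _ (HI T0))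
        (ex_RInt_continuous (V := R_CompleteNormedModule) f T0 b (fun z _ => Hc z))).
      unfold plus in Hch; simpl in Hch.
      unfold minus, plus, opp; simpl. lra.
- apply Hl2. intros y [T [HT ->]]. now apply HU.
Qed.

Lemma continuous_bessel_I0 (x : R) : continuous bessel_I0 x.
Proof.
apply (ex_derive_continuous bessel_I0). eexists. apply is_derive_bessel_I0.
Qed.

Lemma continuous_bessel_R (x : R) : continuous bessel_R x.
Proof.
apply (continuous_ext (fun x => x * I1_over_x x * / bessel_I0 x)).
{ intros t. unfold bessel_R. now rewrite bessel_I1_PSeries. }
apply (continuous_mult (fun x => x * I1_over_x x) (fun x => / bessel_I0 x)).
- apply (continuous_mult (fun x => x) I1_over_x); [apply continuous_id|].
  destruct (is_derive_I1_over_x x) as [d [Hd _]].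
  apply (ex_derive_continuous I1_over_x). now exists d.
- apply continuous_Rinv_comp; [apply continuous_bessel_I0|].
  assert (H := bessel_I0_ge_1 x). lra.
Qed.

Lemma continuous_g_integrand (s t : R) : continuous (g_integrand s) t.
Proof.
assert (Hx : continuous (fun t => 2 * s * sqrt t) t).
(* [sqrt] is 0 on negative reals, hence continuous on the whole line. *)
{ apply (continuous_mult (fun _ => 2 * s) sqrt); [apply continuous_const | apply continuous_sqrt]. }
apply (continuous_mult
  (fun t => s * t * exp (- s * (1 + t)) * bessel_I0 (2 * s * sqrt t))
  (fun t => 1 - bessel_R (2 * s * sqrt t) ^ 2)).
- apply (continuous_mult (fun t => s * t * exp (- s * (1 + t)))
    (fun t => bessel_I0 (2 * s * sqrt t))).
  + apply (ex_derive_continuous (fun t => s * t * exp (- s * (1 + t)))). auto_derive. exact I.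
  + apply (continuous_comp _ bessel_I0 _ Hx), continuous_bessel_I0.
- apply (continuous_comp (fun t => bessel_R (2 * s * sqrt t)) (fun y => 1 - y ^ 2)).
  + apply (continuous_comp _ bessel_R _ Hx), continuous_bessel_R.
  + apply (ex_derive_continuous (fun y => 1 - y ^ 2)). auto_derive. exact I.
Qed.

Lemma weight_nonneg (s t : R) : 0 <= t -> 0 <= weight s t.
Proof.
intros Ht. unfold weight. rewrite <- bessel_I0_weight by easy.
apply Rmult_le_pos; [left; apply exp_pos|]. assert (H := bessel_I0_ge_1 (2 * s * sqrt t)). lra.
Qed.

Lemma g_integrand_weight (s t : R) : 0 <= t ->
  g_integrand s t = weight s t * (s * t * (1 - bessel_R (2 * s * sqrt t) ^ 2)).
Proof.
intros Ht. unfold g_integrand, weight. rewrite <- bessel_I0_weight by easy. ring.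
Qed.

(** At [x = 2 s sqrt t], the main term [s t / x] is [sqrt t / 2] and the error [3 s t / x^2] is
    [3 / (4 s)], uniformly in [t]. *)
Lemma bessel_factor_bounds (s t : R) (b := s * t * (1 - bessel_R (2 * s * sqrt t) ^ 2)) :
  0 < s -> 0 < t ->
  0 <= b /\ Rabs (b - sqrt t / 2) <= 3 / 4 * / s.
Proof.
intros Hs Ht. assert (Hr := sqrt_lt_R0 t Ht). assert (Hr2 := pow2_sqrt t (Rlt_le _ _ Ht)).
assert (Hx : 0 < 2 * s * sqrt t) by (apply Rmult_lt_0_compat; lra).
assert (Hst : 0 < s * t) by now apply Rmult_lt_0_compat.
assert (Ha := one_minus_bessel_R_sqr_asymptotic _ Hx).
assert (Hl := bessel_R_lower _ Hx).
assert (H0 : 0 <= bessel_R (2 * s * sqrt t) / (2 * s * sqrt t))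
  by (apply Rdiv_le_0_compat; [apply bessel_R_nonneg; lra | easy]).
unfold b. split; [apply Rmult_le_pos; lra|].
replace (s * t * _ - sqrt t / 2) with
  (s * t * (1 - bessel_R (2 * s * sqrt t) ^ 2 - / (2 * s * sqrt t))).
- rewrite Rabs_mult, (Rabs_pos_eq (s * t)) by lra.
  apply (Rmult_le_compat_l (s * t)) in Ha; [|lra].
  apply Rle_trans with (1 := Ha), Req_le.
  rewrite !Rpow_mult_distr, Hr2. field. lra.
- set (r := sqrt t) in *. rewrite <- Hr2. field. lra.
Qed.

Lemma g_integrand_upper (s t : R) : 0 < s -> 0 < t ->
  g_integrand s t <= (/ 4 + 3 / 4 * / s) * (weight s t * t ^ 0) + / 4 * (weight s t * t ^ 1).
Proof.
intros Hs Ht. rewrite g_integrand_weight by lra.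
destruct (bessel_factor_bounds s t Hs Ht) as [_ H]. apply Rabs_le_between in H.
assert (Hw := weight_nonneg s t (Rlt_le _ _ Ht)).
assert (Hr2 := pow2_sqrt t (Rlt_le _ _ Ht)).
assert (Hq : sqrt t <= (1 + t) / 2) by (assert (H1 := pow2_ge_0 (sqrt t - 1)); nra).
replace (_ + _) with (weight s t * (/ 4 + 3 / 4 * / s + / 4 * t)) by ring.
apply Rmult_le_compat_l; [easy | lra].
Qed.

(** With [r = sqrt t], the gap is [(r-1)^2 r (r+2) / 2]. The quadratic loss only contributes order
    [1/s^2] once integrated against the weight, which concentrates at [t = 1]. *)
Lemma sqrt_quadratic_lower (t : R) : 0 <= t ->
  1 + (t - 1) / 2 - (t - 1) ^ 2 / 2 <= sqrt t.
Proof.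
intros Ht. assert (Hr2 := pow2_sqrt t Ht). assert (Hr := sqrt_pos t).
rewrite <- Hr2 at 1 2. set (r := sqrt t) in *.
assert (0 <= (r - 1) ^ 2 * (r * (r + 2))).
{ apply Rmult_le_pos; [apply pow2_ge_0|]. nra. }
nra.
Qed.

Lemma g_integrand_lower (s t : R) : 0 < s -> 0 < t ->
  - (3 / 4 * / s) * (weight s t * t ^ 0) + (3 / 4 * (weight s t * t ^ 1)
    + - / 4 * (weight s t * t ^ 2)) <= g_integrand s t.
Proof.
intros Hs Ht. rewrite g_integrand_weight by lra.
destruct (bessel_factor_bounds s t Hs Ht) as [_ H]. apply Rabs_le_between in H.
assert (Hw := weight_nonneg s t (Rlt_le _ _ Ht)).
assert (Hq := sqrt_quadratic_lower t (Rlt_le _ _ Ht)).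
(* Half of the quadratic minorant of [sqrt t] is [3/4 t - t^2/4]; its constant term cancels. *)
replace (_ + _) with (weight s t * (- (3 / 4 * / s) + 3 / 4 * t - / 4 * t ^ 2)) by ring.
apply Rmult_le_compat_l; [easy | lra].
Qed.

Lemma is_RInt_lin2 (f1 f2 : R -> R) (a b I1 I2 c1 c2 : R) :
  is_RInt f1 a b I1 -> is_RInt f2 a b I2 ->
  is_RInt (fun t => c1 * f1 t + c2 * f2 t) a b (c1 * I1 + c2 * I2).
Proof.
intros H1 H2. apply (is_RInt_plus (V := R_NormedModule));
  now apply (is_RInt_scal (V := R_NormedModule)).
Qed.

Lemma g_asymptotic (s : R) : 1 <= s -> Rabs (g s - / (2 * s)) <= 3 / 2 * / s ^ 2.
Proof.
intros Hs1. assert (Hs : 0 < s) by lra. assert (Hi := Rinv_0_lt_compat s Hs).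
assert (Hi1 : / s <= 1) by (rewrite <- Rinv_1; apply Rinv_le_contravar; lra).
destruct (weight_moment_0 s Hs) as [H0 L0]. destruct (weight_moment_1 s Hs) as [H1 L1].
assert (L2 := weight_moment_2 s Hs).
assert (HI : forall T, is_RInt (g_integrand s) 0 T (RInt (g_integrand s) 0 T)).
{ intros T. apply (RInt_correct (V := R_CompleteNormedModule)), ex_RInt_continuous.
  intros t _. apply continuous_g_integrand. }
destruct (is_RInt_gen_nonneg_bounded (g_integrand s)
  ((/ 4 + 3 / 4 * / s) * / s + / 4 * (/ s * (1 + / s)))) as [l [Hl [HU HF]]].
- apply continuous_g_integrand.
- intros t Ht. rewrite g_integrand_weight by lra. apply Rmult_le_pos.
  + apply weight_nonneg. lra.
  + now apply bessel_factor_bounds.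
- intros T HT.
  apply Rle_trans with ((/ 4 + 3 / 4 * / s) * weight_moment s 0 T + / 4 * weight_moment s 1 T).
  + refine (is_RInt_le _ _ _ _ _ _ HT (HI T) (is_RInt_lin2 _ _ _ _ _ _ _ _
      (is_RInt_weight_moment s 0 T) (is_RInt_weight_moment s 1 T)) _).
    intros t Ht. now apply g_integrand_upper.
  + apply Rplus_le_compat; apply Rmult_le_compat_l; [lra | auto | lra | auto].
- replace (g s) with l.
  2:{ symmetry. apply is_RInt_gen_unique. exact Hl. }
  assert (Hlow : - (3 / 4 * / s) * / s + (3 / 4 * (/ s * (1 + / s))
    + - / 4 * (/ s * (1 + 4 * / s + 2 * / s ^ 2))) <= l).
  { refine (is_lim_le_loc (fun T => - (3 / 4 * / s) * weight_moment s 0 T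
      + (3 / 4 * weight_moment s 1 T + - / 4 * weight_moment s 2 T))
      (fun _ => l) p_infty (Finite _) (Finite l) _ _ _).
    2: { apply (is_lim_plus' _ _ _ (- (3 / 4 * / s) * / s)
           (3 / 4 * (/ s * (1 + / s)) + - / 4 * (/ s * (1 + 4 * / s + 2 * / s ^ 2)))).
         - apply (is_lim_scal_l _ (- (3 / 4 * / s)) _ _ L0).
         - apply (is_lim_plus' _ _ _ (3 / 4 * (/ s * (1 + / s)))).
           + apply (is_lim_scal_l _ (3 / 4) _ _ L1).
           + apply (is_lim_scal_l _ (- / 4) _ _ L2). }
    2: apply is_lim_const.
    exists 0. intros T HT. cbv beta. apply Rle_trans with (2 := HF T (Rlt_le _ _ HT)).
    (* The factor 1 gives the three-term combination the shape of two nested [is_RInt_lin2]. *)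
    replace (3 / 4 * weight_moment s 1 T + - / 4 * weight_moment s 2 T) with
      (1 * (3 / 4 * weight_moment s 1 T + - / 4 * weight_moment s 2 T)) by ring.
    refine (is_RInt_le _ _ _ _ _ _ (Rlt_le _ _ HT) (is_RInt_lin2 _ _ _ _ _ _ _ _
      (is_RInt_weight_moment s 0 T) (is_RInt_lin2 _ _ _ _ _ _ _ _
      (is_RInt_weight_moment s 1 T) (is_RInt_weight_moment s 2 T))) (HI T) _).
    intros t Ht. cbv beta. rewrite Rmult_1_l. now apply g_integrand_lower. }
  (* The moments give [u/2 - u^2 - u^3/2 <= g s <= u/2 + u^2] with [u = 1/s <= 1]. *)
  rewrite Rinv_mult, <- pow_inv in *. set (u := / s) in *.
  apply Rabs_le_between. split; nra.
Qed.

Lemma g_hat_asymptotic (s : R) : 8 <= s -> Rabs (g_hat s - / (2 * s)) <= 5 / 2 * / s ^ 2.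
Proof.
intros Hs8. assert (Hs : 0 < s) by lra. assert (Hi := Rinv_0_lt_compat s Hs).
assert (Hi8 : / s <= / 8) by (apply Rinv_le_contravar; lra).
assert (Hpi := PI_RGT_0). assert (Hz : 0 < s / 2) by lra.
set (K := sqrt (2 / (PI * (s / 2)))).
assert (HK : sqrt (PI / s) * K = 2 * / s).
{ unfold K. rewrite <- sqrt_mult_alt by (left; now apply Rdiv_lt_0_compat).
  replace (PI / s * (2 / (PI * (s / 2)))) with ((2 * / s) ^ 2) by (field; lra).
  apply sqrt_pow2. lra. }
assert (Hlo := bessel_I0_lower (s / 2) ltac:(lra)). assert (Hup := bessel_I0_upper (s / 2) Hz).
fold K in Hlo, Hup.
assert (Hr1 := bessel_R_le_1 (s / 2) Hz). assert (Hr2 := one_minus_bessel_R_le (s / 2) Hz).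
assert (Hgh : g_hat s = / 4 * (sqrt (PI / s) * exp (- s / 2) * bessel_I0 (s / 2))
  * (1 + / s + bessel_R (s / 2))).
{ unfold g_hat, bessel_R. field. assert (H := bessel_I0_ge_1 (s / 2)). lra. }
(* [c] cancels the leading behaviour of [I_0(s/2)]: [c I_0(s/2)] lies between [u (1 - u)] and
   [u (1 + 4 u)] for [u = 1/s]. *)
set (c := sqrt (PI / s) * exp (- s / 2)) in *.
assert (Hc : 0 <= c) by (apply Rmult_le_pos; [apply sqrt_pos | left; apply exp_pos]).
assert (HcK : c * (K * exp (s / 2)) = 2 * / s).
{ rewrite <- HK. unfold c.
  replace (sqrt (PI / s) * exp (- s / 2) * (K * exp (s / 2))) with
    (sqrt (PI / s) * K * (exp (- s / 2) * exp (s / 2))) by ring.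
  rewrite <- exp_plus. replace (- s / 2 + s / 2) with 0 by field. rewrite exp_0. ring. }
apply (Rmult_le_compat_l c) in Hlo; [|easy]. apply (Rmult_le_compat_l c) in Hup; [|easy].
replace (c * (K * (exp (s / 2) / 2 * (1 - / (2 * (s / 2)))))) with
  (c * (K * exp (s / 2)) * (1 - / s) / 2) in Hlo by (field; lra).
replace (c * (K * (exp (s / 2) / 2 * (1 + 2 / (s / 2))))) with
  (c * (K * exp (s / 2)) * (1 + 4 * / s) / 2) in Hup by (field; lra).
rewrite HcK in Hlo, Hup. rewrite Hgh.
replace (/ (s / 2) + 2 * / (s / 2) ^ 2) with (2 * / s + 8 * / s ^ 2) in Hr2 by (field; lra).
rewrite Rinv_mult, <- pow_inv in *.
set (u := / s) in *. set (r := bessel_R (s / 2)) in *. set (v := c * bessel_I0 (s / 2)) in *.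
(* [2 u + 8 u^2 <= 3 u] holds exactly when [u <= 1/8], whence the threshold 8. *)
assert (Hr3 : 1 - 3 * u <= r) by nra.
assert (Hv : 0 <= v) by nra.
apply Rabs_le_between. split.
- assert (u * (1 - u) * (2 - 2 * u) <= v * (1 + u + r))
    by (apply Rmult_le_compat; nra). nra.
- assert (v * (1 + u + r) <= u * (1 + 4 * u) * (2 + u))
    by (apply Rmult_le_compat; nra). nra.
Qed.

(* r(gamma) = O(1/gamma) as gamma -> +oo *)
Theorem theorem3 :
  exists C M : R, 0 < M /\
    forall gamma : R, M <= gamma -> Rabs (rel_err gamma) <= C * / gamma.
Proof.
(* The errors [3/2 u^2] and [5/2 u^2] add up to [4 u^2], and the denominator is at least
   [u/2 - 3/2 u^2 >= u/4]; the quotient is [16 u]. *)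
exists 16, 8. split; [lra|]. intros s Hs.
assert (Hi := Rinv_0_lt_compat s ltac:(lra)).
assert (Hi8 : / s <= / 8) by (apply Rinv_le_contravar; lra).
assert (H1 := g_asymptotic s ltac:(lra)). assert (H2 := g_hat_asymptotic s Hs).
rewrite Rinv_mult, <- pow_inv in H1, H2. unfold rel_err. set (u := / s) in *.
assert (Hd : Rabs (g_hat s - g s) <= 4 * u ^ 2).
{ apply Rabs_le_between. apply Rabs_le_between in H1. apply Rabs_le_between in H2. lra. }
apply Rabs_le_between in H1. assert (Hden : u / 4 <= u - g s) by nra.
rewrite Rabs_pos_eq.
- apply Rle_div_l; [lra|]. nra.
- apply Rdiv_le_0_compat; [apply Rabs_pos | lra].
Qed.
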